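(* Let $\varepsilon\in\{1,-1\}$, let $k\ge 1$ be an integer, and let $A_{k-1}(n)=a_{k-1}n^{k-1}+\cdots+a_1 n+a_0$ be a polynomial with integer coefficients. Then the summation formula $$\sum_{i=0}^{n-1}\varepsilon^i\, i!\,\bigl[i^k+A_{k-1}(1)-\varepsilon A_{k-1}(0)\bigr] = -\varepsilon A_{k-1}(0)+\varepsilon^{n-1}\, n!\, A_{k-1}(n)$$ holds for all integers $n\ge 1$ if and only if the identity $$(n+1)A_{k-1}(n+1)-\varepsilon A_{k-1}(n)=n^k+A_{k-1}(1)-\varepsilon A_{k-1}(0)$$ holds for all integers $n\ge 0$. *)

(* Defs.v *)
From mathcomp Require Export all_boot all_order all_algebra.

(* Main.v *)
Require Import Defs.
From mathcomp Require Import all_boot all_order all_algebra.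
From mathcomp Require Import ring.
Import GRing.Theory Num.Theory.
Local Open Scope ring_scope.

(** The summation formula is a telescoping sum in disguise. A closed form
    [R n] for the partial sums of a sequence [u] is valid for all [n >= 1]
    exactly when it is right at [n = 1] and its differences
    [R (n + 1) - R n] are the terms [u n] ([sum_eqP]). Here
    [R n = - eps * A(0) + eps ^ (n - 1) * n! * A(n)], and because
    [eps ^ 2 = 1] its difference factors
    ([signed_fact_diff]) as
    [eps ^ n * n! * ((n + 1) * A(n + 1) - eps * A(n))].
    The term [u n] carries the same nonzero factor [eps ^ n * n!], so
    cancelling it turns the difference equation at [n] into the functional
    identity at [n]. This covers [n >= 1]; both the formula at [n = 1] and the
    identity at [n = 0] hold automatically, since [0 ^ k = 0] for [k >= 1]. *)

Lemma sum_eqP (V : zmodType) (u R : nat -> V) :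
  (forall n, (1 <= n)%N -> \sum_(0 <= i < n) u i = R n) <->
  u 0%N = R 1%N /\ forall n, u n.+1 = R n.+2 - R n.+1.
Proof.
split=> [sumE | [u0 uS] [//|n] _].
  split=> [|n]; first by rewrite -sumE // big_nat1.
  by rewrite -!sumE // [in RHS]big_nat_recr //= addrAC subrr add0r.
elim: n => [|n IHn]; first by rewrite big_nat1.
by rewrite big_nat_recr //= IHn uS addrC subrK.
Qed.

(** Since [eps] is its own inverse, [eps ^ n = eps ^ (n + 1) * eps]; this is
    what lets both terms share the factor [eps ^ (n + 1) * (n + 1)!]. *)
Lemma signed_fact_diff (R : comPzRingType) (eps x y : R) (n : nat) :
  eps * eps = 1 ->
  eps ^+ n.+1 * (n.+2)`!%:R * y - eps ^+ n * (n.+1)`!%:R * x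
  = eps ^+ n.+1 * (n.+1)`!%:R * (n.+2%:R * y - eps * x).
Proof.
move=> eps2; rewrite (factS n.+1) natrM.
have -> : eps ^+ n = eps ^+ n.+1 * eps by rewrite exprSr -mulrA eps2 mulr1.
by ring.
Qed.

Theorem theorem1 (eps : int) (heps : eps = 1 \/ eps = -1)
    (k : nat) (hk : (1 <= k)%N)
    (A : {poly int}) (hA : (size A <= k)%N) :
  (forall n : nat, (1 <= n)%N ->
     \sum_(0 <= i < n)
        eps ^+ i * (i`!)%:Z * (i%:Z ^+ k + A.[1] - eps * A.[0])
     = - eps * A.[0] + eps ^+ (n - 1) * (n`!)%:Z * A.[n%:Z])
  <->
  (forall n : nat,
     (n%:Z + 1) * A.[n%:Z + 1] - eps * A.[n%:Z]
     = n%:Z ^+ k + A.[1] - eps * A.[0]).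
Proof.
have eps2 : eps * eps = 1 by case: heps => ->.
have zero_k : 0%:Z ^+ k = 0 by rewrite expr0n eqn0Ngt hk.
have weight_neq0 n : eps ^+ n * n`!%:Z != 0.
  rewrite mulf_neq0 ?expf_neq0 //; first by case: heps => ->.
  by rewrite -lt0n fact_gt0.
set u := fun i : nat =>
  eps ^+ i * i`!%:Z * (i%:Z ^+ k + A.[1] - eps * A.[0]).
set R := fun n : nat =>
  - eps * A.[0] + eps ^+ (n - 1) * n`!%:Z * A.[n%:Z].
have u0 : u 0%N = R 1%N.
  by rewrite /u /R zero_k subnn expr0 fact0 !mul1r add0r mulNr addrC.
have RS n : R n.+2 - R n.+1 = eps ^+ n.+1 * (n.+1)`!%:Z *
    ((n.+1%:Z + 1) * A.[n.+1%:Z + 1] - eps * A.[n.+1%:Z]).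
  rewrite -[n.+1%:Z + 1]PoszD addn1 /R !subn1 /= opprD addrACA subrr add0r.
  by have := signed_fact_diff _ eps A.[n.+1%:Z] A.[n.+2%:Z] n eps2; rewrite !natz.
apply: iff_trans (sum_eqP _ u R) _; split=> [[_ uS] [|n] | id].
- by rewrite zero_k !add0r mul1r.
- by apply: (mulfI (weight_neq0 n.+1)); rewrite -RS -uS.
- by split=> // n; rewrite RS id.
Qed.
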